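(* Let $\kappa$ be an infinite cardinal. Assume that $(X,\tau)$ is a regular space such that $t(X)\leq\kappa$ and every open cover of $X$ of size at most $2^\kappa$ admits a subcover of size at most $\kappa$. Then $\ell(X)\leq\kappa$.
   Context: ''Regular'' includes $\mathsf{T}_1$. The tightness $t(X)$ of a space $X$ is the minimum cardinal $\lambda$ such that whenever $x\in\mathrm{cl}(A)$ for some $A\subseteq X$, there exists $B\subseteq A$ with $|B|\leq\lambda$ and $x\in\mathrm{cl}(B)$. The Lindelöf number $\ell(X)$ of a space $X$ is the least cardinal $\lambda$ such that every open cover of $X$ has a subcover of size at most $\lambda$. *)

(* Defs.v *)
From mathcomp Require Import all_boot boolp classical_sets functions cardinality topology.
Set Implicit Arguments.
Unset Strict Implicit.
Unset Printing Implicit Defensive.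
Local Open Scope classical_set_scope.
Local Open Scope card_scope.

(* A cardinal is represented by a type; cardinals are compared through [#<=]
   on the full sets of these types. *)
Definition least_cardinal (P : Type -> Prop) (L : Type) : Prop :=
  P L /\ forall M : Type, P M -> [set: L] #<= [set: M].

(* [regular_space] alone does not entail T1. *)
Definition regular_T1_space (X : topologicalType) : Prop :=
  accessible_space X /\ regular_space X.

Definition is_tightness (X : topologicalType) : Type -> Prop :=
  least_cardinal (fun L : Type =>
    forall (A : set X) (x : X), closure A x ->
      exists B : set X, [/\ B `<=` A, B #<= [set: L] & closure B x]).

Definition open_cover (X : topologicalType) (U : set (set X)) : Prop :=
  U `<=` open /\ cover U id = [set: X].

Definition has_subcover_le (X : topologicalType) (U : set (set X)) (L : Type)
    : Prop :=
  exists V : set (set X),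
    [/\ V `<=` U, cover V id = [set: X] & V #<= [set: L]].

Definition is_lindelof_number (X : topologicalType) : Type -> Prop :=
  least_cardinal (fun L : Type =>
    forall U : set (set X), open_cover U -> has_subcover_le U L).

(* The cardinals t(X) and l(X) are only determined up to equipotence, so
   t(X) <= |K| and l(X) <= |K| are stated through a representative [L]. *)
Definition tightness_le (X : topologicalType) (K : Type) : Prop :=
  exists2 L : Type, is_tightness X L & [set: L] #<= [set: K].

Definition lindelof_number_le (X : topologicalType) (K : Type) : Prop :=
  exists2 L : Type, is_lindelof_number X L & [set: L] #<= [set: K].

(* Main.v *)
Require Import Defs.
From mathcomp Require Import all_boot boolp classical_sets functions cardinality topology.
Set Implicit Arguments.
Unset Strict Implicit.
Unset Printing Implicit Defensive.
Local Open Scope classical_set_scope.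
Local Open Scope card_scope.

(** Write k for the cardinal of [K], and suppose that an open cover [U] has no
    subcover of size at most k.

    A closure of a set of at most k points is covered by at most k members of
    [U]: by regularity, every point of cl(B) has a neighbourhood N such that
    the closure of the trace of N on B lies in one member of [U], and B has at
    most 2^k subsets; so at most 2^k members of [U] cover cl(B), and the covering
    hypothesis, applied to them together with the complement of cl(B), leaves
    k of them ([closure_range_subcover]).  Fix such a subfamily [Phi b] for
    every b : K -> X.  For any k sequences b_i, the union of the [Phi b_i] has
    at most k * k = k members, hence misses a point, and we choose one.

    Let D be the least set that contains a given point and contains the point
    chosen for (b_i) as soon as all the b_i take their values in D.  The
    elements of D are the values of well-founded trees with k * k branches at
    each node, and there are only 2^k such trees ([card_tree_le]).  By
    tightness, cl(D) is covered by the unions of the [Phi b] with b in D, of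
    which there are at most 2^k; by the covering hypothesis again, k of them suffice,
    say those for the sequences b_i ([closed_subcover]).  But the point chosen
    for (b_i) is in D and in none of them.

    Closing D under the choice of points takes the place of a transfinite
    recursion of length k^+.  The cardinal arithmetic rests on k * k = k
    ([pairing_of_infinite]), and the existence of the Lindelöf number as a
    least cardinal rests on [least_type_family]; both come from Zorn's lemma. *)

(** * Comparison of cardinals *)

(** Consider sets of choice functions that pairwise differ at every index, and take a
    maximal one, S.  If every coordinate missed a value of its type, the
    missed values would form a choice function extending S; so some coordinate
    i maps S onto T i, while every coordinate is injective on S.  Totality of
    the comparison of cardinals and its well-foundedness are both instances. *)
Lemma least_type_family (I : Type) (T : I -> Type) :
  inhabited I ->
  exists i, forall j, exists f : T i -> T j, injective f.
Proof.
move=> [i0].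
pose P : set (set (forall i, T i)) := [set S | forall s t, S s -> S t ->
  forall i, s i = t i -> s = t].
have [F FP Ftot|S [PS maxS]] := @Zorn_bigcup _ P.
  move=> s t [A FA As] [B FB Bt].
  have [AB|BA] := Ftot A B FA FB.
  - by apply: (FP B) => //; apply: AB.
  - by apply: (FP A) => //; apply: BA.
have [i Si] : exists i, forall y : T i, exists2 s, S s & s i = y.
  apply: contrapT => noi.
  have newpt i : {y : T i | forall s, S s -> s i <> y}.
    apply: cid; apply: contrapT => noy; apply: noi; exists i => y.
    apply: contrapT => nos; apply: noy; exists y => s Ss sy.
    by apply: nos; exists s.
  pose t i := sval (newpt i).
  have tS i : forall s, S s -> s i <> t i := svalP (newpt i).
  apply: (maxS (S `|` [set t])).
    split; first by left.
    by move=> /(_ t (or_intror erefl)) St; exact: (tS i0 t St erefl).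
  move=> s s' [Ss|->] [Ss'|->] i // e; first exact: (PS _ _ _ _ i).
  - by case: (tS i s Ss e).
  - by case: (tS i s' Ss' (esym e)).
exists i => j.
have /choice [g gS] : forall y : T i, exists s, S s /\ s i = y.
  by move=> y; have [s Ss sy] := Si y; exists s.
exists (fun y => g y j) => y z /(PS _ _ (gS y).1 (gS z).1) e.
by rewrite -(gS y).2 -(gS z).2 e.
Qed.

Lemma injective_card_le (T U : Type) (f : T -> U) :
  injective f -> [set: T] #<= [set: U].
Proof.
move=> f_inj; rewrite -(card_le_eql (inj_card_eq (A := setT) (f := f) _)).
  exact: card_leT.
by move=> x y _ _; exact: f_inj.
Qed.

Lemma card_le_total (T U : Type) (A : set T) (B : set U) :
  A #<= B \/ B #<= A.
Proof.
rewrite -!(card_le_eql (card_setT A)) -!(card_le_eqr (card_setT A)).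
rewrite -!(card_le_eql (card_setT B)) -!(card_le_eqr (card_setT B)).
have [[] /(_ _) f] := @least_type_family bool
  (fun b => if b then set_type A else set_type B) (inhabits true).
- by left; have [g /injective_card_le] := f false.
- by right; have [g /injective_card_le] := f true.
Qed.

(** Every cardinal is either above that of [K] or that of a subset of [K], so it
    is enough to minimize over the subsets of [K].  This also keeps the family
    to which [least_type_family] is applied in the universe of [K]. *)
Lemma least_cardinal_le (P : Type -> Prop) (K : Type) :
  (forall M N : Type, [set: M] #<= [set: N] -> P M -> P N) ->
  P K -> exists2 L : Type, least_cardinal P L & [set: L] #<= [set: K].
Proof.
move=> Pmono PK.
have PT : P (set_type [set: K]).
  by apply: Pmono PK; rewrite (card_le_eqr (card_setT _)).
have [[C PC] /= Cmin] := @least_type_family {C : set K | P (set_type C)}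
  (fun C => set_type (sval C)) (inhabits (exist _ _ PT)).
have CK : [set: C] #<= [set: K].
  by rewrite (card_le_eql (card_setT _)) card_leT.
exists (set_type C) => //; split=> // M PM.
have [/card_subP[D DM _]|KM] := card_le_total [set: M] [set: K].
  have PD : P (set_type D).
    by apply: Pmono PM; rewrite (card_le_eqr (card_setT _)) (card_le_eqr DM).
  have [g /injective_card_le] := Cmin (exist _ D PD).
  by rewrite [in X in X -> _](card_le_eqr (card_setT _)) (card_le_eqr DM).
exact: card_le_trans CK KM.
Qed.

(** * Cardinal arithmetic below the powerset *)

(** By Zorn's lemma there is a maximal pair (A, f) where f is injective from
    A * A to A, and A contains two fixed points, which serve as tags.  If A
    injects into its complement, a copy of A can be adjoined to A: the pairs
    that f does not treat are coded by a few applications of f and sent into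
    the copy, against maximality.  Hence the complement of A injects into A,
    and tagging makes [K] itself inject into A. *)
Lemma pairing_of_infinite (K : Type) :
  infinite_set [set: K] -> exists p : K * K -> K, injective p.
Proof.
elim/Ppointed: K => K; first by rewrite emptyE => /(_ (finite_set0 _)).
move=> /infiniteP /pcard_leTP[e].
have e_inj : injective e by move=> m n; apply: inj; rewrite inE.
pose good (Af : set K * (K * K -> K)) :=
  [/\ Af.1 (e 0%N), Af.1 (e 1%N),
      forall x y, Af.1 x -> Af.1 y -> Af.1 (Af.2 (x, y)) &
      forall x y x' y', Af.1 x -> Af.1 y -> Af.1 x' -> Af.1 y' ->
        Af.2 (x, y) = Af.2 (x', y') -> x = x' /\ y = y'].
pose S := {Af | good Af}.
pose ext (s t : S) := `[< (sval s).1 `<=` (sval t).1 /\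
  forall x y, (sval s).1 x -> (sval s).1 y ->
    (sval s).2 (x, y) = (sval t).2 (x, y) >].
(* The image of nat, with the pairing of nat, starts the Zorn argument. *)
have [d dK] : exists d : K -> nat, forall n, d (e n) = n.
  exists (fun x => xget 0%N [set n | e n = x]) => n; apply: e_inj.
  by apply: (@xgetPex _ 0%N [set m | e m = e n]); exists n.
have good0 : good (range e, fun xy => e (pickle (d xy.1, d xy.2))).
  split => /=; [by exists 0%N|by exists 1%N| |].
    by move=> x y _ _; exists (pickle (d x, d y)).
  move=> _ _ _ _ [m _ <-] [n _ <-] [m' _ <-] [n' _ <-].
  by rewrite !dK => /e_inj /(pcan_inj pickleK) [-> ->].
have [[[A f] Agood] maxA] : exists s, premaximal ext s.
  apply: (@ZL_preorder S (exist _ _ good0)).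
  - by move=> s; apply/asboolP; split.
  - move=> r s t /asboolP[rs rsE] /asboolP[st stE]; apply/asboolP; split.
      exact: subset_trans st.
    by move=> x y rx ry; rewrite rsE // stE //; apply: rs.
  move=> C Ctot; have [[s0 Cs0]|C0] := pselect (exists s, C s); last first.
    by exists (exist _ _ good0) => s Cs; case: C0; exists s.
  pose U := \bigcup_(s in C) (sval s).1.
  have both x y : U x -> U y -> exists2 s, C s & (sval s).1 x /\ (sval s).1 y.
    move=> [s Cs sx] [t Ct ty].
    have [/asboolP[st _]|/asboolP[ts _]] := Ctot s t Cs Ct.
    - by exists t => //; split=> //; apply: st.
    - by exists s => //; split=> //; apply: ts.
  have /choice [g gP] : forall xy, exists z, forall s, C s ->
      (sval s).1 xy.1 -> (sval s).1 xy.2 -> (sval s).2 xy = z.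
    move=> [x y] /=.
    have [[s [Cs sx sy]]|nos] :=
      pselect (exists s, [/\ C s, (sval s).1 x & (sval s).1 y]); last first.
      by exists x => s Cs sx sy; case: nos; exists s.
    exists ((sval s).2 (x, y)) => t Ct tx ty.
    by have [/asboolP[_ ->]|/asboolP[_ ->]] := Ctot s t Cs Ct.
  have goodU : good (U, g).
    split => /=.
    - by exists s0 => //; case: (svalP s0).
    - by exists s0 => //; case: (svalP s0).
    - move=> x y Ux Uy; have [s Cs [sx sy]] := both x y Ux Uy.
      by rewrite -(gP (x, y) s) //; exists s => //; case: (svalP s) => _ _ + _; apply.
    move=> x y x' y' Ux Uy Ux' Uy'.
    have [s Cs [sx sy]] := both x y Ux Uy.
    have [t Ct [tx' ty']] := both x' y' Ux' Uy'.
    have [u Cu [su tu]] : exists2 u, C u &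
        (sval s).1 `<=` (sval u).1 /\ (sval t).1 `<=` (sval u).1.
      have [/asboolP[st _]|/asboolP[ts _]] := Ctot s t Cs Ct.
      - by exists t => //; split.
      - by exists s => //; split.
    have [ux uy ux' uy'] := And4 (su x sx) (su y sy) (tu x' tx') (tu y' ty').
    rewrite -(gP (x, y) u) // -(gP (x', y') u) //.
    by case: (svalP u) => _ _ _; apply.
  exists (exist _ _ goodU) => s Cs; apply/asboolP; split => /=.
    by move=> x sx; exists s.
  by move=> x y sx sy; apply: gP.
have [/= A0 A1 fA finj] := Agood.
have e01 : e 0%N <> e 1%N by move=> /e_inj.
have [/pcard_leP[h]|/pcard_leP[h]] := card_le_total A (~` A).
- have hN x : A x -> ~ A (h x) := @funS _ _ A (~` A) h x.
  have h_inj x y : A x -> A y -> h x = h y -> x = y.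
    by move=> Ax Ay; apply: (@inj _ _ A h); rewrite inE.
  pose B := A `|` h @` A.
  have [r rA rK] : exists2 r : K -> K, forall x, A x -> r x = x &
      forall x, A x -> r (h x) = x.
    exists (fun x => if `[< A x >] then x else xget x [set y | A y /\ h y = x]).
    - by move=> x Ax; rewrite asboolT.
    - move=> x Ax; rewrite asboolF; last exact: hN.
      case: xgetP => [y -> [Ay /h_inj]|/(_ x)]; first by apply.
      by case.
  (* A point of B is determined by its representative r x in A and by the tag
     that tells A from its copy. *)
  pose tag x := if `[< A x >] then e 0%N else e 1%N.
  have tagA x : A (tag x) by rewrite /tag; case: asboolP.
  have rB x : B x -> A (r x) by move=> [Ax|[y Ay <-]]; [rewrite rA|rewrite rK].
  have tag_inj x y : B x -> B y -> tag x = tag y -> r x = r y -> x = y.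
    rewrite /tag => -[Ax|[x' Ax' <-]] -[Ay|[y' Ay' <-]].
    + by rewrite !rA.
    + by rewrite asboolT // asboolF //; apply: hN.
    + by rewrite asboolF ?asboolT //; [move=> /esym|apply: hN].
    + by rewrite !rK // => _ ->.
  pose c x y := f (f (tag x, tag y), f (r x, r y)).
  have cA x y : B x -> B y -> A (c x y).
    by move=> Bx By; apply: (fA); apply: (fA) => //; apply: rB.
  have c_inj x y x' y' : B x -> B y -> B x' -> B y' ->
      c x y = c x' y' -> x = x' /\ y = y'.
    move=> Bx By Bx' By' /finj [||||]; do ?[by apply: fA => //; apply: rB].
    move=> /finj[] // tx ty /finj[]; do ?[exact: rB].
    by move=> rx ry; split; apply: tag_inj.
  pose g xy := if `[< A xy.1 /\ A xy.2 >] then f xy else h (c xy.1 xy.2).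
  have goodB : good (B, g).
    split => /=; [by left|by left| |].
    + move=> x y Bx By; rewrite /g /=; case: asboolP => [[Ax Ay]|_].
        by left; apply: fA.
      by right; exists (c x y) => //; apply: cA.
    + move=> x y x' y' Bx By Bx' By'; rewrite /g /=.
      case: asboolP => [[Ax Ay]|_]; case: asboolP => [[Ax' Ay']|_].
      * exact: finj.
      * by move=> ff; case: (hN (c x' y')); rewrite -?ff; [apply: cA|apply: fA].
      * by move=> ff; case: (hN (c x y)); rewrite ?ff; [apply: cA|apply: fA].
      * by move=> /h_inj hh; apply: c_inj => //; apply: hh; apply: cA.
  have /asboolP[/= BA _] : ext (exist _ _ goodB) (exist _ _ Agood).
    apply: maxA; apply/asboolP; split=> /= [x Ax|x y Ax Ay]; first by left.
    by rewrite /g /= asboolT.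
  by case: (hN (e 0%N) A0); apply: BA; right; exists (e 0%N).
- have hA x : ~ A x -> A (h x) := @funS _ _ (~` A) A h x.
  have h_inj x y : ~ A x -> ~ A y -> h x = h y -> x = y.
    by move=> Ax Ay; apply: (@inj _ _ (~` A) h); rewrite inE.
  pose g x := if `[< A x >] then f (e 0%N, x) else f (e 1%N, h x).
  have gA x : A (g x).
    by rewrite /g; case: asboolP => Ax; apply: fA => //; apply: hA.
  have g_inj : injective g.
    move=> x y; rewrite /g; case: asboolP => Ax; case: asboolP => Ay.
    + by move=> /finj[].
    + by move=> /finj[] //; apply: hA.
    + by move=> /finj[] //; [apply: hA|move=> /esym].
    + by move=> /finj[]; do ?[exact: hA] => // _; apply: h_inj.
  exists (fun xy => f (g xy.1, g xy.2)) => -[x y] [x' y'] /= /finj[] //.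
  by move=> /g_inj -> /g_inj ->.
Qed.

Lemma infinite_two_points (K : Type) :
  infinite_set [set: K] -> exists x y : K, x <> y.
Proof.
move=> infK; have [x _] := infinite_setN0 infK; exists x.
apply: contrapT => nox; apply: infK.
apply: sub_finite_set (finite_set1 x) => y _.
by apply: contrapT => yx; apply: nox; exists y => xy; apply: yx.
Qed.

(** The terms built from one constant by one operation of arity [J]: the values
    of these terms form the least set that contains the constant and is closed
    under the operation. *)
Inductive tree (J : Type) : Type := leaf | node (f : J -> tree J).
Arguments leaf {J}.
Arguments node {J} f.

(** A tree is determined by the set of its paths from the root to a [node].
    With a pairing of [K], a path is coded by an element of [K]: the tag k0
    marks the empty path, and the tag k1 a path that starts with a given
    index. *)
Lemma card_tree_le (K : Type) :
  infinite_set [set: K] -> [set: tree (K * K)] #<= [set: set K].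
Proof.
move=> infK; have [p p_inj] := @pairing_of_infinite K infK.
have [k0 [k1 k01]] := infinite_two_points infK.
pose fix code (t : tree (K * K)) : set K := match t with
  | leaf => set0
  | node f => [set p (k0, k0)] `|`
      \bigcup_ij [set p (k1, p (p ij, x)) | x in code (f ij)]
  end.
have root_in f : code (node f) (p (k0, k0)) by left.
have branch_in f ij x : code (node f) (p (k1, p (p ij, x))) <-> code (f ij) x.
  split=> [[/p_inj[/esym]//|[ij' _ [y fy] /p_inj[/p_inj[/p_inj <- <-]]//]]|fx].
  by right; exists ij => //; exists x.
apply: (@injective_card_le _ _ code).
elim=> [|f IH] [|g] // e.
- by have := root_in g; rewrite -e.
- by have := root_in f; rewrite e.
congr node; apply: functional_extensionality_dep => ij; apply: IH.
apply/seteqP; split=> x.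
- by move=> /branch_in; rewrite e => /branch_in.
- by move=> /branch_in; rewrite -e => /branch_in.
Qed.

(** The subsets of [K] are first encoded as nonempty subsets, which frees the
    empty set for the new element. *)
Lemma card_leU1_powerset (K T : Type) (x : T) (A : set T) :
  infinite_set [set: K] -> A #<= [set: set K] ->
  x |` A #<= [set: set K].
Proof.
move=> infK /pcard_injP[f f_inj].
have [p p_inj] := @pairing_of_infinite K infK.
have [k0 [k1 k01]] := infinite_two_points infK.
pose g y : set K := if `[< y = x >] then set0
  else p (k0, k0) |` [set p (k1, k) | k in f y].
have g_in y : y <> x -> g y (p (k0, k0)).
  by move=> yx; rewrite /g asboolF //; left.
have g_out y k : y <> x -> g y (p (k1, k)) <-> f y k.
  move=> yx; rewrite /g asboolF //; split=> [[/p_inj[/esym]//|]|fk].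
    by move=> [k' fk' /p_inj[<-]].
  by right; exists k.
apply/pcard_injP; exists g => y z /set_mem yA /set_mem zA e.
have gx : g x = set0 by rewrite /g asboolT.
have [yx|yx] := pselect (y = x); have [zx|zx] := pselect (z = x).
- by rewrite yx zx.
- by have := g_in z zx; rewrite -e yx gx.
- by have := g_in y yx; rewrite e zx gx.
case: yA => // yA; case: zA => // zA.
apply: f_inj; rewrite ?inE //; apply/seteqP; split=> k.
- by move=> /(g_out y k yx); rewrite e => /(g_out z k zx).
- by move=> /(g_out z k zx); rewrite -e => /(g_out y k yx).
Qed.

(** * Subcovers of closed sets *)

(** The complement of F completes a cover of F to a cover of X, and it covers
    no point of F, so it can be dropped from the subcover. *)
Lemma closed_subcover (K : Type) (X : topologicalType)
    (F : set X) (W : set (set X)) :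
  infinite_set [set: K] ->
  (forall U : set (set X), open_cover U -> U #<= [set: set K] ->
     has_subcover_le U K) ->
  closed F -> W `<=` open -> W #<= [set: set K] -> F `<=` cover W id ->
  exists V, [/\ V `<=` W, V #<= [set: K] & F `<=` cover V id].
Proof.
move=> infK covX clF Wop Wle FW.
have [V [VW Vcov Vle]] : has_subcover_le ([set ~` F] `|` W) K.
  apply: covX; last exact: card_leU1_powerset.
  split=> [_ [->|/Wop//]|]; first exact: closed_openC.
  apply/seteqP; split=> // x _; have [/FW[w Ww wx]|nFx] := pselect (F x).
    by exists w => //; right.
  by exists (~` F) => //; left.
exists (V `&` W); split=> [v []//||x Fx].
  exact: card_le_trans (subset_card_le (@subIsetl _ _ _)) Vle.
have [v Vv vx] : cover V id x by rewrite Vcov.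
by exists v => //; split=> //; case: (VW v Vv) => // vF; move: vx; rewrite vF.
Qed.

(** [W] picks one member of [U] around cl(b @` A) for every A : set K for which
    there is one.  It covers cl(range b): if N is a neighbourhood of x whose
    closure lies in a member of [U], then A = b @^-1` N is such a set and x
    is in cl(b @` A). *)
Lemma closure_range_subcover (K : Type) (X : topologicalType)
    (U : set (set X)) (b : K -> X) :
  infinite_set [set: K] ->
  (forall U : set (set X), open_cover U -> U #<= [set: set K] ->
     has_subcover_le U K) ->
  regular_space X -> open_cover U ->
  exists V, [/\ V `<=` U, V #<= [set: K] & closure (range b) `<=` cover V id].
Proof.
move=> infK covX regX [Uop Ucov].
pose small (A : set K) u := U u /\ closure (b @` A) `<=` u.
pose W := (fun A => xget set0 (small A)) @` [set A | small A !=set0].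
have WU : W `<=` U.
  by move=> _ [A /= [u uA] <-]; case: (xgetPex set0 (ex_intro _ u uA)).
have [||x clx|V [VW Vle Vcov]] :=
    @closed_subcover K X (closure (range b)) W infK covX (@closed_closure _ _).
- exact: subset_trans WU Uop.
- exact: card_le_trans (card_image_le _ _) (card_leT _).
- have [u Uu ux] : cover U id x by rewrite Ucov.
  have [N Nx Nu] := regX x u (open_nbhs_nbhs (conj (Uop u Uu) ux)).
  have smallN : small (b @^-1` N) u.
    split=> //; apply: subset_trans Nu; apply: closureS.
    by move=> _ [k Nk <-].
  exists (xget set0 (small (b @^-1` N))).
    by exists (b @^-1` N) => //; exists u.
  have [_] := xgetPex set0 (ex_intro _ u smallN); apply.
  move=> M Mx; have [_ [[k _ <-] [Nk Mk]]] := clx _ (filterI Nx Mx).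
  by exists (b k); split=> //; exists k.
by exists V; split=> //; apply: subset_trans VW WU.
Qed.

Lemma tightness_le_closure (K : Type) (X : topologicalType) (A : set X) (x : X) :
  tightness_le X K -> closure A x ->
  exists B : set X, [/\ B `<=` A, B #<= [set: K] & closure B x].
Proof.
move=> [L [tL _] LK] /tL[B [BA BL Bx]].
by exists B; split=> //; apply: card_le_trans LK.
Qed.

Lemma card_bigcup_le (K T : Type) (V : K -> set T) :
  infinite_set [set: K] -> (forall k, V k #<= [set: K]) ->
  \bigcup_k V k #<= [set: K].
Proof.
elim/Ppointed: T => T in V *; first by rewrite !emptyE.
move=> infK Vle.
have /choice[e eV] : forall k, exists g : K -> T, V k `<=` range g.
  by move=> k; apply/pcard_surjP.
have [p /injective_card_le] := @pairing_of_infinite K infK.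
apply: card_le_trans; apply/pcard_surjP; exists (fun ij => e ij.1 ij.2).
by move=> y [k _ /(eV k)[j _ <-]]; exists (k, j).
Qed.

(** * Closing off under the choice of uncovered points *)

Theorem theorem5p3 (K : Type) (X : topologicalType)
    (infK : infinite_set [set: K])
    (regX : regular_T1_space X)
    (tX : tightness_le X K)
    (covX : forall U : set (set X), open_cover U -> U #<= [set: set K] ->
       has_subcover_le U K) :
  lindelof_number_le X K.
Proof.
apply: least_cardinal_le => [M N MN PM U /PM[V [VU Vcov VM]]|U Uoc].
  by exists V; split=> //; apply: card_le_trans MN.
apply: contrapT => noK; have [Uop Ucov] := Uoc.
(* By the choice of U, no k of its members cover X. *)
have escape V : V `<=` U -> V #<= [set: K] -> exists x, ~ cover V id x.
  move=> VU Vle; apply: contrapT => nox; apply: noK; exists V; split=> //.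
  by apply/seteqP; split=> // x _; apply: contrapT => nVx; apply: nox; exists x.
have [x0 _] := escape set0 (@sub0set _ _) (card_ge0 _ _).
have [_ reg] := regX.
have /choice[Phi PhiP] : forall b : K -> X, exists V,
    [/\ V `<=` U, V #<= [set: K] & closure (range b) `<=` cover V id].
  by move=> b; apply: closure_range_subcover.
have /choice[q qP] : forall h : K * K -> X, exists x,
    forall i, ~ cover (Phi (fun j => h (i, j))) id x.
  move=> h; have [||x nx] := escape (\bigcup_i Phi (fun j => h (i, j))).
  - by move=> v [i _]; have [+ _ _] := PhiP (fun j => h (i, j)); apply.
  - by apply: card_bigcup_le => // i; case: (PhiP (fun j => h (i, j))).
  by exists x => i [v Phiv vx]; apply: nx; exists v => //; exists i.
(* range eval is the closed-off set D. *)
pose fix eval (t : tree (K * K)) : X := match t with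
  | leaf => x0 | node f => q (fun ij => eval (f ij)) end.
pose G (f : K -> tree (K * K)) := cover (Phi (eval \o f)) id.
have Gop f : open (G f).
  apply: bigcup_open => v Phiv; apply: Uop.
  by have [+ _ _] := PhiP (eval \o f); apply.
have [||x clx|V [VW Vle Vcov]] := @closed_subcover K X
    (closure (range eval)) (range G) infK covX (@closed_closure _ _).
- by move=> _ [f _ <-]; exact: Gop.
- apply: card_le_trans (card_image_le _ _) _.
  apply: card_le_trans _ (card_tree_le infK).
  (* A node whose children repeat f encodes f as a tree. *)
  apply: (@injective_card_le _ _ (fun f => node (fun ij => f ij.1))).
  move=> f g [] fg; apply: functional_extensionality_dep => k.
  exact: (congr1 (fun F => F (k, k)) fg).
- have [B [BD /pfcard_geP[->|[g]] clBx]] := tightness_le_closure tX clx.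
    by have [y []] := clBx _ filterT.
  have /choice[f fg] : forall k, exists t, eval t = g k.
    by move=> k; have [|t _ <-] := BD (g k); [exact: funS|exists t].
  exists (G f); first by exists f.
  have [_ _] := PhiP (eval \o f); apply; apply: closureS clBx => y.
  by move=> /(@surj _ _ setT B g)[k _ <-]; exists k => //=; exact: fg.
have /pcard_surjP[e Ve] := Vle.
have /choice[f fP] : forall k, exists f, V (e k) -> e k = G f.
  move=> k; have [/VW[f _ <-]|nV] := pselect (V (e k)); first by exists f.
  by exists (fun=> leaf) => /nV.
(* The contradiction: the value of t is the point chosen for the k sequences
   eval \o f k, whose families cover cl(D). *)
pose t := node (fun ij => f ij.1 ij.2).
have [v Vv vt] := Vcov (eval t) (subset_closure (ex_intro2 _ _ t I erefl)).
have [k _ ekv] := Ve v Vv.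
apply: (qP (fun ij => eval (f ij.1 ij.2)) k).
have fk : e k = G (f k) by apply: fP; rewrite ekv.
by move: vt; rewrite -ekv fk.
Qed.
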